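(* There exist a countable first-order signature $L$, a countable relational expansion $L^{*}$ of $L$, a Fraïssé structure $\mathbf{F}$ in $L$ and a Fraïssé precompact relational expansion $\mathbf{F}^{*}$ of $\mathbf{F}$ in $L^{*}$ such that, with $G=\mathrm{Aut}(\mathbf{F})$ and $G^{*}=\mathrm{Aut}(\mathbf{F}^{*})$, the flow $G\curvearrowright X^{*}$ on $X^{*}=\widehat{G/G^{*}}$ is universal but $\mathrm{Age}(\mathbf{F}^{*})$ does not have the Ramsey property.
   Context: $\mathbb{N}=\{0,1,2,\ldots\}$ and $[k]=\{0,\ldots,k-1\}$. $L^{*}=L\cup\{R_i : i\in I^{*}\}$, where $I^{*}$ is countable and each $R_i$ is a relation symbol not in $L$. A Fraïssé structure is a countable (infinite), locally finite (finitely generated substructures are finite), ultrahomogeneous structure (every isomorphism between finite substructures extends to an automorphism). $\mathrm{Age}(\mathbf{F})$ is the class of finite structures that embed in $\mathbf{F}$. An expansion $\mathbf{F}^{*}$ of $\mathbf{F}$ in $L^{*}$ is an $L^{*}$-structure whose $L$-reduct is $\mathbf{F}$; ''Fraïssé expansion'' means $\mathbf{F}^{*}$ is itself a Fraïssé structure in $L^{*}$. It is precompact if every element of $\mathrm{Age}(\mathbf{F})$ has only finitely many expansions in $\mathrm{Age}(\mathbf{F}^{*})$. Both $\mathbf{F}$ and $\mathbf{F}^{*}$ have universe $\mathbb{N}$, so $G^{*}\leq G$ are closed subgroups of $S_\infty$, the group of permutations of $\mathbb{N}$ with the topology of pointwise convergence. Let $d_L(g,h)=2^{-m}$ with $m=\min\{n\in\mathbb{N}: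 g(n)\neq h(n)\}$ (and $d_L(g,g)=0$), and let $d_R(g,h)=d_L(g^{-1},h^{-1})$, a right-invariant metric on $G$. It projects to a metric on $G/G^{*}=\{gG^{*}:g\in G\}$ (the distance between two cosets is the infimum of the distances between their elements). $X^{*}=\widehat{G/G^{*}}$ is the completion of this metric space, and $G\curvearrowright X^{*}$ is the continuous action extending left multiplication on $G/G^{*}$. All topological spaces are Hausdorff. A $G$-flow is a continuous action of $G$ on a (nonempty) topological space $X$; it is compact if $X$ is compact, and minimal if every $x\in X$ has a dense orbit. A flow $G\curvearrowright X$ is universal if for every compact minimal $G$-flow $G\curvearrowright Y$ there is a continuous, surjective, $G$-equivariant map $\pi:X\to Y$. $\binom{\mathbf{B}}{\mathbf{A}}$ is the set of substructures of $\mathbf{B}$ isomorphic to $\mathbf{A}$. A class $\mathcal{C}$ of finite structures has the Ramsey property if for every $k\in\mathbb{N}$ and $\mathbf{A},\mathbf{B}\in\mathcal{C}$ there exists $\mathbf{C}\in\mathcal{C}$ such that for every $c:\binom{\mathbf{C}}{\mathbf{A}}\to[k]$ there is $\widetilde{\mathbf{B}}\in\binom{\mathbf{C}}{\mathbf{B}}$ such that $c$ takes at most one value on $\binom{\widetilde{\mathbf{B}}}{\mathbf{A}}$. *)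

(* Defs.v *)
From HB Require Import structures.
From mathcomp Require Import all_boot all_order all_algebra.
From mathcomp Require Import all_classical all_reals.
From mathcomp Require Import topology.

Set Implicit Arguments.
Unset Strict Implicit.
Unset Printing Implicit Defensive.

Import Order.TTheory GRing.Theory Num.Theory.

Local Open Scope classical_set_scope.

(* Symbols range over countTypes, so signatures are (at most) countable.
   Constants are function symbols of arity 0. *)
Record signature := Signature {
  fsym : countType;
  fsym_arity : fsym -> nat;
  rsym : countType;
  rsym_arity : rsym -> nat }.

Record structure (L : signature) (T : Type) := Structure {
  fun_interp : forall s : fsym L, ('I_(fsym_arity s) -> T) -> T;
  rel_interp : forall r : rsym L, ('I_(rsym_arity r) -> T) -> Prop }.

Section Structures.
Variable L : signature.

Definition embedding T U (M : structure L T) (N : structure L U)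
    (f : T -> U) : Prop :=
  [/\ injective f,
      forall (s : fsym L) (t : 'I_(fsym_arity s) -> T),
        f (fun_interp M t) = fun_interp N (f \o t)
    & forall (r : rsym L) (t : 'I_(rsym_arity r) -> T),
        rel_interp M t <-> rel_interp N (f \o t)].

Definition isomorphism T U (M : structure L T) (N : structure L U)
    (f : T -> U) : Prop :=
  [/\ bijective f,
      forall (s : fsym L) (t : 'I_(fsym_arity s) -> T),
        f (fun_interp M t) = fun_interp N (f \o t)
    & forall (r : rsym L) (t : 'I_(rsym_arity r) -> T),
        rel_interp M t <-> rel_interp N (f \o t)].

(* A substructure is identified with its universe; the empty universe is
   allowed whenever L has no constants. *)
Definition substructure T (M : structure L T) (S : set T) : Prop :=
  forall (s : fsym L) (t : 'I_(fsym_arity s) -> T),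
    (forall i, S (t i)) -> S (fun_interp M t).

Lemma fun_interp_in T (M : structure L T) (S : set T) (hS : substructure M S)
    (s : fsym L) (t : 'I_(fsym_arity s) -> S) :
  fun_interp M (fun i => set_val (t i)) \in S.
Proof. by apply/mem_set/hS => i; exact: set_valP. Qed.

Definition induced T (M : structure L T) (S : set T)
    (hS : substructure M S) : structure L S :=
  @Structure L S
    (fun s t => exist _ (fun_interp M (fun i => set_val (t i)))
                        (fun_interp_in hS t))
    (fun r t => rel_interp M (fun i => set_val (t i))).

(* The set of substructures of B that are isomorphic to A. *)
Definition copies T U (B : structure L U) (A : structure L T) : set (set U) :=
  [set S | exists (hS : substructure B S) (f : T -> S),
             isomorphism A (induced hS) f].

Definition locally_finite T (M : structure L T) : Prop :=
  forall A : set T, finite_set A -> finite_set (smallest (substructure M) A).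

Definition ultrahomogeneous T (M : structure L T) : Prop :=
  forall (S S' : set T) (hS : substructure M S) (hS' : substructure M S')
         (f : S -> S'),
    finite_set S -> finite_set S' ->
    isomorphism (induced hS) (induced hS') f ->
    exists2 g : T -> T, isomorphism M M g
      & forall x : S, g (set_val x) = set_val (f x).

(* The universe nat makes the structure countably infinite. *)
Definition Fraisse (F : structure L nat) : Prop :=
  locally_finite F /\ ultrahomogeneous F.

Definition finite_class := forall T : finType, structure L T -> Prop.

Definition Age (F : structure L nat) : finite_class :=
  fun T A => exists f : T -> nat, embedding A F f.

(* The copies of A in a substructure B' of C are exactly the copies of A in C
   whose universe is contained in B'. *)
Definition Ramsey_property (K : finite_class) : Prop :=
  forall (k : nat) (TA TB : finType) (A : structure L TA) (B : structure L TB),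
    K TA A -> K TB B ->
    exists (TC : finType) (C : structure L TC), K TC C /\
      forall c : copies C A -> 'I_k,
        exists2 B' : set TC, copies C B B' &
          forall A1 A2 : copies C A,
            set_val A1 `<=` B' -> set_val A2 `<=` B' -> c A1 = c A2.

End Structures.

Section Expansions.
Variables (L : signature) (I : countType) (ar : I -> nat).

Definition expand_signature : signature :=
  @Signature (fsym L) (@fsym_arity L) (rsym L + I)%type
    (fun r => match r with inl r => rsym_arity r | inr i => ar i end).

Definition reduct T (M : structure expand_signature T) : structure L T :=
  @Structure L T (fun s => @fun_interp expand_signature T M s)
    (fun r => @rel_interp expand_signature T M (inl r)).

Definition precompact_expansion (F : structure L nat)
    (Fs : structure expand_signature nat) : Prop :=
  forall (T : finType) (A : structure L T), Age F A ->
    finite_set [set As : structure expand_signature T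
                 | reduct As = A /\ Age Fs As].

End Expansions.

Section AutomorphismGroup.
Variables (L : signature) (M : structure L nat).

(* The carrier is a subtype of {ptws nat -> nat} (with nat discrete), whose
   topology is that of pointwise convergence. *)
Definition Aut : Type :=
  set_type [set g : {ptws nat -> nat} | isomorphism M M g].

HB.instance Definition _ := Topological.on Aut.

Definition aut_fun (g : Aut) : nat -> nat := set_val g.

Lemma aut_funP (g : Aut) : isomorphism M M (aut_fun g).
Proof. exact: (set_valP g). Qed.

Lemma aut_inj (g h : Aut) : aut_fun g =1 aut_fun h -> g = h.
Proof. by move=> gh; apply: val_inj; apply/funext. Qed.

Definition mk_aut (g : nat -> nat) (hg : isomorphism M M g) : Aut :=
  exist _ (g : {ptws nat -> nat}) (mem_set hg).

Lemma iso_id : isomorphism M M id.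
Proof. by split => //; exists id. Qed.

Lemma iso_comp g h : isomorphism M M g -> isomorphism M M h ->
  isomorphism M M (g \o h).
Proof.
move=> [bg fg rg] [bh fh rh]; split; first exact: bij_comp.
- by move=> s t /=; rewrite fh fg.
- by move=> r t; rewrite rh rg.
Qed.

Lemma iso_inv g : isomorphism M M g ->
  exists h : nat -> nat, [/\ isomorphism M M h, cancel g h & cancel h g].
Proof.
move=> [[h gK hK] fg rg]; exists h; split => //; split; first by exists g.
- move=> s t; apply: (can_inj gK); rewrite hK fg; congr fun_interp.
  by apply/funext => i /=; rewrite hK.
- move=> r t; have {1}-> : t = g \o (h \o t) by apply/funext => i /=; rewrite hK.
  by rewrite -rg.
Qed.

Definition aut_one : Aut := mk_aut iso_id.

Definition aut_mul (g h : Aut) : Aut :=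
  mk_aut (iso_comp (aut_funP g) (aut_funP h)).

Definition aut_inv (g : Aut) : Aut :=
  let: exist _ p := cid (iso_inv (aut_funP g)) in let: And3 hiso _ _ := p in
  mk_aut hiso.

Lemma aut_mulA : associative aut_mul.
Proof. by move=> f g h; exact: aut_inj. Qed.

Lemma aut_mul1g : left_id aut_one aut_mul.
Proof. by move=> g; exact: aut_inj. Qed.

Lemma aut_mulg1 : right_id aut_one aut_mul.
Proof. by move=> g; exact: aut_inj. Qed.

Lemma aut_mulVg : left_inverse aut_one aut_inv aut_mul.
Proof.
move=> g; apply: aut_inj => n; rewrite /aut_inv.
by case: cid => h [hiso gK hK] /=; exact: gK.
Qed.

Lemma aut_mulgV : right_inverse aut_one aut_inv aut_mul.
Proof.
move=> g; apply: aut_inj => n; rewrite /aut_inv.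
by case: cid => h [hiso gK hK] /=; exact: hK.
Qed.

HB.instance Definition _ := isGroup.Build Aut
  aut_mulA aut_mul1g aut_mulg1 aut_mulVg aut_mulgV.

End AutomorphismGroup.

Coercion aut_fun : Aut >-> Funclass.

Section Flows.
Variables (L : signature) (M : structure L nat).

Definition flow (X : topologicalType) (a : Aut M -> X -> X) : Prop :=
  [/\ hausdorff_space X /\ [set: X] !=set0,
      forall x, a 1%g x = x,
      forall g h x, a (g * h)%g x = a g (a h x)
    & continuous (fun p : Aut M * X => a p.1 p.2)].

Definition minimal_flow (X : topologicalType) (a : Aut M -> X -> X) : Prop :=
  forall x : X, dense (range (fun g => a g x)).

Definition universal_flow (X : topologicalType) (a : Aut M -> X -> X) : Prop :=
  forall (Y : topologicalType) (b : Aut M -> Y -> Y),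
    flow b -> compact [set: Y] -> minimal_flow b ->
    exists p : X -> Y,
      [/\ continuous p, range p = [set: Y]
        & forall g x, p (a g x) = b g (p x)].

End Flows.

Section Completion.
Local Open Scope ring_scope.
Variable R : realType.

Definition dist_left (g h : nat -> nat) : R :=
  match pselect (exists n, g n != h n) with
  | left e => 2 ^- ex_minn e
  | right _ => 0
  end.

Definition dist_right L (M : structure L nat) (g h : Aut M) : R :=
  dist_left (g^-1 : Aut M)%g (h^-1 : Aut M)%g.

(* X, together with i : Q -> X, is a completion of Q for the distance d; it is
   unique up to a unique isometry compatible with i. *)
Definition is_completion (Q : Type) (d : Q -> Q -> R) (X : metricType R)
    (i : Q -> X) : Prop :=
  [/\ forall p q, mdist (i p) (i q) = d p q,
      dense (range i)
    & forall F : set_system X, ProperFilter F -> cauchy F ->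
        exists x : X, F --> x].

End Completion.

Section Cosets.
Variables (L : signature) (I : countType) (ar : I -> nat).
Variables (F : structure L nat) (Fs : structure (expand_signature L ar) nat).

(* Aut Fs as a subset of Aut F; when reduct Fs = F, every automorphism of Fs
   is an automorphism of F. *)
Definition Aut_expansion : set (Aut F) := [set g | isomorphism Fs Fs g].

Definition left_coset (g : Aut F) : set (Aut F) :=
  [set (g * k)%g | k in Aut_expansion].

Definition coset_space : Type := set_type (range left_coset).

Definition coset_proj (g : Aut F) : coset_space :=
  exist _ (left_coset g) (mem_set (imageT left_coset g)).

Definition coset_dist (R : realType) (p q : coset_space) : R :=
  inf [set r | exists g h, [/\ set_val p g, set_val q h
                             & r = dist_right R g h]].

(* Cosets are dense in X, so at most one continuous action on X satisfies
   this. *)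
Definition extends_left_mul (X : Type) (i : coset_space -> X)
    (a : Aut F -> X -> X) : Prop :=
  forall g h : Aut F, a g (i (coset_proj h)) = i (coset_proj (g * h)%g).

End Cosets.

(* Main.v *)
From HB Require Import structures.
Require Import Defs.
From mathcomp Require Import all_boot all_order all_algebra.
From mathcomp Require Import all_classical all_reals.
From mathcomp Require Import topology.
From mathcomp Require Import finmap zify lra.

(** The structure [F] is the order of the rationals, and [F*] expands it by an
    equivalence relation with exactly two classes, both dense. The classes are
    not named, so an automorphism of [F*] may exchange them.

    The group [Aut F] is extremely amenable: each of its compact flows has a
    fixed point ([flow_fixed_point]). If not, then by compactness finitely many
    open sets [O d], each moved off itself by some [h d], cover the flow, and
    this remains so up to automorphisms fixing a finite set [A] of rationals.
    Fix a point [y0] and colour the copies [g A] of [A] by some [d] with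
    [g^-1 y0] in [O d]. By [ramsey], some [g] maps [A] and its image under the
    corresponding [h d] to copies of the same colour [d], and this contradicts
    the choice of [O d]. Hence a compact minimal flow is a single point
    ([minimal_flow_trivial]), and every nonempty flow of [Aut F] is universal,
    whether or not it is minimal.

    On the other hand, [Age F*] is not Ramsey already for points: colour the
    points of a structure of the age by their class. A pair of inequivalent
    points is never monochromatic ([rat_classes_not_Ramsey]).

    The remaining work is to present the flow on the completion of [G / G*].
    The coset of [g] is identified with the image of the equivalence relation
    under [g] ([base]). The completion is then the space of all equivalence
    relations on [nat] with at most two classes: every finite pattern is
    realized by an image under some [g] ([base_dense]), and by
    ultrahomogeneity of [F*] the distance of two cosets is [2 ^- n], for [n]
    the first point where the classes of [0] in the two relations differ
    ([coset_dist_base]). Both ultrahomogeneity statements and the realization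
    of patterns come from one back-and-forth argument ([extension]). *)

Set Implicit Arguments.
Unset Strict Implicit.
Unset Printing Implicit Defensive.

Import Order.TTheory GRing.Theory Num.Theory.

Local Open Scope classical_set_scope.

(** * Ramsey's theorem *)

(** Infinite pigeonhole principle. *)
Lemma infinitely_often (T : eqType) (D : seq T) (u : nat -> T) :
  (forall n, u n \in D) ->
  exists2 d, d \in D & forall N, exists2 n, N <= n & u n = d.
Proof.
elim: D u => [|d D IH] u uD; first by have := uD 0.
case: (pselect (exists N, forall n, N <= n -> u n != d)) => [[N uN]|often].
  have [n|d' d'D often] := IH (fun n => u (N + n)).
    by have := uD (N + n); rewrite inE (negPf (uN _ (leq_addr _ _))).
  exists d'; first by rewrite inE d'D orbT.
  move=> M; have [n Mn <-] := often M; exists (N + n) => //; lia.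
exists d; first by rewrite mem_head.
move=> N; apply: contrapT => H; apply: often; exists N => n Nn.
by apply/eqP => und; apply: H; exists n.
Qed.

Definition increasing (f : nat -> nat) := {homo f : i j / i < j}.

Lemma increasing_step f : (forall n, f n < f n.+1) -> increasing f.
Proof. by move=> fS; apply: homo_ltn => //; exact: ltn_trans. Qed.


(** Ramsey's theorem, with the [n]-subsets of [nat] represented by the strictly
    increasing sequences of length [n]. *)
Lemma ramsey (T : eqType) (D : seq T) (n : nat) (c : seq nat -> T) :
  (forall s, c s \in D) ->
  exists phi d, [/\ increasing phi, d \in D &
    forall s, sorted ltn s -> size s = n -> c (map phi s) = d].
Proof.
elim: n c => [|n IH] c cD.
  by exists id, (c [::]); split=> // -[].
(* one refinement step of the current subsequence [psi] *)
have step (psi : nat -> nat) : exists phi d, [/\ increasing phi, d \in D &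
    forall s, sorted ltn s -> size s = n ->
      c (psi 0 :: map (psi \o succn \o phi) s) = d].
  have [//|phi [d [phiI dD cphi]]] :=
    IH (fun s => c (psi 0 :: map (psi \o succn) s)).
  by exists phi, d; split=> // s ss sn; rewrite -(cphi s) // -map_comp.
have [next next_spec] := choice step.
have [col col_spec] := choice next_spec.
pose psi := fix psi j :=
  if j is j'.+1 then psi j' \o succn \o next (psi j') else id.
have psiI j : increasing (psi j).
  elim: j => // j IHj a b ab /=; apply: IHj; rewrite ltnS.
  by have [nI _ _] := col_spec (psi j); apply: nI.
pose a j := psi j 0.
have aI : increasing a.
  by apply: increasing_step => j; rewrite /a /=; apply: psiI.
(* a later term of [a] lies in the range of [psi j.+1] *)
have psi_range k j i : exists i', psi (k + j) i = psi j i'.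
  elim: k i => [|k IHk] i; first by exists i.
  by rewrite addSn /=; apply: IHk.
have a_range i j : j < i -> exists i', a i = psi j.+1 i'.
  by move=> ji; rewrite /a -(subnK ji); exact: psi_range.
have [|d dD often] := @infinitely_often T D (fun j => col (psi j)).
  by move=> j; have [] := col_spec (psi j).
have often_idx N : exists k, N <= k /\ col (psi k) = d.
  by have [k] := often N; exists k.
have [sub sub_spec] := choice often_idx.
pose idx := fix idx j := if j is j'.+1 then sub (idx j').+1 else sub 0.
have idxI : increasing idx.
  by apply: increasing_step => j /=; have [] := sub_spec (idx j).+1.
have idx_col j : col (psi (idx j)) = d.
  by case: j => [|j]; [have [] := sub_spec 0|have [] := sub_spec (idx j).+1].
exists (a \o idx), d; split=> //.
  by move=> i j ij; apply: aI; exact: idxI.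
case=> [//|i s] /= is_sorted [sn].
have i_lt : {in s, forall j, i < j}.
  apply/allP; exact: (order_path_min ltn_trans is_sorted).
have [inv inv_spec] : exists inv, {in s, forall j,
    a (idx j) = psi (idx i).+1 (inv j)}.
  have H j : exists i', j \in s -> a (idx j) = psi (idx i).+1 i'.
    case: (boolP (j \in s)) => [js|_]; last by exists 0.
    by have [i' ->] := a_range _ _ (idxI _ _ (i_lt _ js)); exists i'.
  by have [inv invP] := choice H; exists inv.
have [_ _ /(_ (map inv s))] := col_spec (psi (idx i)).
rewrite idx_col size_map => <- //.
  rewrite -map_comp; congr (c (_ :: _)); apply/eq_in_map => j js.
  exact: inv_spec.
apply: (homo_sorted_in (P := mem s)) (path_sorted is_sorted); last first.
  by apply/allP => j.
move=> j k js ks jk; rewrite /= ltnNge; apply/negP => kj.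
have : a (idx j) < a (idx k) by apply: aI; exact: idxI.
rewrite (inv_spec _ js) (inv_spec _ ks) ltnNge => /negP; apply.
by move: kj; rewrite leq_eqVlt => /orP[/eqP->//|/(psiI (idx i).+1)/ltnW].
Qed.

(** * The rationals with two dense colours *)

Section Triadic.
Variable R : archiRealFieldType.

(** Rationals of the form [z / 3 ^ n]: a dense set with dense complement. *)
Definition triadic (r : R) : Prop :=
  exists (z : int) (n : nat), r = (z%:~R / 3 ^+ n)%R.

Lemma triadic_dense (a b : R) :
  (a < b)%R -> exists r, [/\ triadic r, (a < r)%R & (r < b)%R].
Proof.
move=> ab; pose m := Num.bound (b - a)^-1%R.
have p3 : (0 < 3 ^+ m :> R)%R by rewrite exprn_gt0.
have m3 : ((b - a)^-1 < 3 ^+ m)%R.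
  apply: (@lt_trans _ _ m%:R%R); last by rewrite -natrX ltr_nat ltn_expl.
  by apply: archi_boundP; rewrite invr_ge0 subr_ge0 ltW.
have len : (1 < (b - a) * 3 ^+ m)%R.
  by rewrite mulrC -ltr_pdivrMr ?subr_gt0 // mul1r.
exists ((Num.floor (a * 3 ^+ m) + 1)%:~R / 3 ^+ m)%R; split.
- by exists (Num.floor (a * 3 ^+ m) + 1)%R, m.
- by rewrite ltr_pdivlMr // floorD1_gt.
rewrite ltr_pdivrMr //; have := floor_le (a * 3 ^+ m)%R.
rewrite intrD; lra.
Qed.

Lemma half_not_triadic : ~ triadic (1 / 2 : R)%R.
Proof.
move=> [z [n]] /eqP; rewrite eqr_div ?expf_neq0 ?pnatr_eq0 // mul1r => /eqP E.
have {E} /eqP : ((3 ^ n)%:R = (z * 2)%:~R :> R)%R by rewrite natrX E intrM.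
rewrite -[_%:R%R]/((Posz (3 ^ n))%:~R)%R eqr_int => /eqP E.
have : odd (3 ^ n) by rewrite oddX orbT.
lia.
Qed.

Lemma triadicB r s : triadic r -> triadic s -> triadic (r - s)%R.
Proof.
move=> [z [n ->]] [w [m ->]]; exists (z * 3 ^+ m - w * 3 ^+ n)%R, (n + m).
rewrite -mulNr addf_div ?expf_neq0 ?pnatr_eq0 // exprD; congr (_ / _)%R.
by rewrite intrB !intrM !rmorphXn /= mulNr.
Qed.

Lemma nontriadic_dense (a b : R) :
  (a < b)%R -> exists r, [/\ ~ triadic r, (a < r)%R & (r < b)%R].
Proof.
move=> ab; have [|r [tr ar rb]] := @triadic_dense (a - 1 / 2)%R (b - 1 / 2)%R.
  by rewrite ltrD2r.
exists (r + 1 / 2)%R; split; [|lra|lra].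
move=> tr2; apply: half_not_triadic.
by have := triadicB tr2 tr; rewrite addrC addKr.
Qed.

End Triadic.

Lemma ratn_subproof : exists q : nat -> rat, bijective q.
Proof.
have /card_esym/card_set_bijP[q qP] := card_rat.
by exists q; rewrite -setTT_bijective.
Qed.

(** An arbitrary enumeration of the rationals. *)
Definition ratn : nat -> rat := sval (cid ratn_subproof).

Lemma ratn_bij : bijective ratn. Proof. exact: svalP (cid ratn_subproof). Qed.

Lemma ratn_inj : injective ratn. Proof. exact: bij_inj ratn_bij. Qed.

(** The order of [nat] transported from the rationals along [ratn]. *)
Definition qlt (x y : nat) : bool := (ratn x < ratn y)%R.

Lemma qltxx x : qlt x x = false. Proof. exact: ltxx. Qed.

Lemma qlt_trans : transitive qlt. Proof. move=> y x z; exact: lt_trans. Qed.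

Lemma qlt_total x y : x != y -> qlt x y || qlt y x.
Proof. by rewrite -(inj_eq ratn_inj) => /lt_total. Qed.

Lemma qlt_asym x y : qlt x y -> qlt y x = false.
Proof. by rewrite /qlt => /ltW; rewrite leNgt => /negPf. Qed.

Lemma qlt_eq x y : qlt x y = false -> qlt y x = false -> x = y.
Proof.
by move=> xy yx; apply/eqP/negPn/negP => /qlt_total; rewrite xy yx.
Qed.

(** Both values of this colouring are taken on a dense set of rationals. *)
Definition color (x : nat) : bool := `[< triadic (ratn x) >].

Lemma color_dense (k : bool) (a b : rat) :
  (a < b)%R -> exists z, [/\ color z = k, (a < ratn z)%R & (ratn z < b)%R].
Proof.
move=> ab; suff [r [rk ar rb]] : exists r : rat,
    [/\ `[< triadic r >] = k, (a < r)%R & (r < b)%R].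
  by have [inv _ invK] := ratn_bij; exists (inv r); rewrite /color !invK.
case: k; have := ab.
  by move=> /triadic_dense[r [tr ar rb]]; exists r; split=> //; apply/asboolP.
by move=> /nontriadic_dense[r [tr ar rb]]; exists r; split=> //; apply/asboolF.
Qed.

(** An open interval fits in every finite cut, one-sided or empty cuts
    included. *)
Lemma separate (s t : seq rat) :
  {in s & t, forall x y, x < y}%R ->
  exists a b, [/\ (a < b)%R, {in s, forall x, x <= a}%R
    & {in t, forall y, b <= y}%R].
Proof.
move=> st.
have [a [sa at_]] : exists a, {in s, forall x, x <= a}%R /\
    {in t, forall y, a < y}%R.
  elim: s st => [|x s IH] st.
    elim: t {st} => [|y t [a [_ IHt]]]; first by exists 0%R.
    exists (Num.min a (y - 1))%R; split=> // z; rewrite inE => /predU1P[->|/IHt].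
      by rewrite gt_min orbC ltrBlDr ltrDl ltr01.
    by rewrite gt_min => ->.
  have [|a [sa at_]] := IH; first by move=> u v us; apply: st; rewrite inE us orbT.
  exists (Num.max x a); split=> z; last first.
    by move=> zt; rewrite gt_max at_ // st ?mem_head.
  by rewrite inE le_max => /predU1P[->|/sa->]; rewrite ?lexx ?orbT.
suff [b [ab bt]] : exists b, (a < b)%R /\ {in t, forall y, b <= y}%R.
  by exists a, b.
elim: t at_ {st} => [|y t IH] at_; first by exists (a + 1)%R; rewrite ltrDl ltr01.
have [|b [ab bt]] := IH; first by move=> z zt; apply: at_; rewrite inE zt orbT.
exists (Num.min y b); rewrite lt_min at_ ?mem_head //; split=> // z.
by rewrite inE ge_min => /predU1P[->|/bt->]; rewrite ?lexx ?orbT.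
Qed.

(** Every finite cut is filled by points of each colour. *)
Lemma color_gap (k : bool) (s t : seq nat) :
  {in s & t, forall x y, qlt x y} ->
  exists z, [/\ color z = k, {in s, forall x, qlt x z}
    & {in t, forall y, qlt z y}].
Proof.
move=> st; have [|a [b [ab sa bt]]] := @separate (map ratn s) (map ratn t).
  by move=> _ _ /mapP[x xs ->] /mapP[y yt ->]; apply: st.
have [z [zk az zb]] := color_dense k ab; exists z; split=> // u us.
  by apply: le_lt_trans az; apply/sa/map_f.
by apply: lt_le_trans zb _; apply/bt/map_f.
Qed.

(** * Back-and-forth *)

(** The finite set of pairs [p] is the graph of a partial embedding of the
    order: as the order is strict and total, the condition makes [p] functional
    and injective. *)
Definition order_pres (p : seq (nat * nat)) : Prop :=
  {in p &, forall u v, qlt u.1 v.1 = qlt u.2 v.2}.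

(** A partial embedding extends to a new point, with an image of any prescribed
    colour. *)
Lemma order_pres_cons p n k :
  order_pres p -> n \notin unzip1 p ->
  exists m, color m = k /\ order_pres ((n, m) :: p).
Proof.
move=> pP np.
have [|m [mk ml mr]] := @color_gap k [seq u.2 | u <- p & qlt u.1 n]
    [seq u.2 | u <- p & qlt n u.1].
  move=> _ _ /mapP[u + ->] /mapP[v + ->].
  rewrite !mem_filter => /andP[un up] /andP[nv vp].
  by rewrite -pP //; apply: qlt_trans nv.
have low u : u \in p -> qlt u.1 n -> qlt u.2 m.
  by move=> up un; apply: ml; apply: map_f; rewrite mem_filter un.
have high u : u \in p -> qlt n u.1 -> qlt m u.2.
  by move=> up un; apply: mr; apply: map_f; rewrite mem_filter un.
have side u : u \in p -> qlt u.1 n \/ qlt n u.1.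
  move=> up; apply/orP/qlt_total/eqP => un.
  by move: np; rewrite -un map_f.
exists m; split=> // u v; rewrite !inE => /predU1P[->|up] /predU1P[->|vp] /=.
- by rewrite !qltxx.
- case: (side v vp) => h; first by rewrite (qlt_asym h) (qlt_asym (low _ vp h)).
  by rewrite h (high _ vp h).
- case: (side u up) => h; first by rewrite h (low _ up h).
  by rewrite (qlt_asym h) (qlt_asym (high _ up h)).
- exact: pP.
Qed.

Lemma order_pres_swap p : order_pres p -> order_pres [seq (u.2, u.1) | u <- p].
Proof. by move=> pP _ _ /mapP[u up ->] /mapP[v vp ->] /=; rewrite pP. Qed.

Lemma order_pres_inj p x y y' :
  order_pres p -> (x, y) \in p -> (x, y') \in p -> y = y'.
Proof.
by move=> pP xy xy'; apply: qlt_eq; rewrite -(pP _ _ xy xy', pP _ _ xy' xy) qltxx.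
Qed.

(** A partial embedding of the order in which the colours of each point and of
    its image are related by [T]. *)
Definition good (T : rel bool) (p : seq (nat * nat)) : Prop :=
  order_pres p /\ {in p, forall u, T (color u.1) (color u.2)}.

Lemma good_sub (T : rel bool) p p' : {subset p' <= p} -> good T p -> good T p'.
Proof.
move=> pp' [pP pT]; split=> [u v up vp|u up]; first by apply: pP; apply: pp'.
exact/pT/pp'.
Qed.

Lemma good_forth (T : rel bool) p n : (forall a, exists b, T a b) -> good T p ->
  exists m, good T ((n, m) :: p).
Proof.
move=> Ttot [pP pT]; case: (boolP (n \in unzip1 p)) => [/mapP[u up ->]|np].
  exists u.2; apply: (@good_sub T p) => // v; rewrite inE => /predU1P[->|//].
  by rewrite -surjective_pairing.
have [k Tk] := Ttot (color n).
have [m [mk mP]] := order_pres_cons k pP np.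
by exists m; split=> // u; rewrite inE => /predU1P[->/=|/pT//]; rewrite mk.
Qed.

Lemma good_swap (T : rel bool) p : good T p ->
  good (fun a b => T b a) [seq (u.2, u.1) | u <- p].
Proof.
move=> [pP pT]; split; first exact: order_pres_swap.
by move=> _ /mapP[u up ->]; apply: pT.
Qed.

Lemma good_back (T : rel bool) p m : (forall b, exists a, T a b) -> good T p ->
  exists n, good T ((n, m) :: p).
Proof.
move=> Ttot /good_swap/(good_forth m Ttot)[n /good_swap].
rewrite /= -map_comp => nP; exists n.
by rewrite -[p]map_id; congr good: nP; congr cons; apply: eq_map => -[].
Qed.

(** Back-and-forth. With the full relation for [T], this is the
    ultrahomogeneity of the order; with the identity or the exchange of the
    colours, that of the order with the two colour classes. *)
Lemma extension (T : rel bool) p :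
  (forall a, exists b, T a b) -> (forall b, exists a, T a b) -> good T p ->
  exists g : nat -> nat, [/\ bijective g, {mono g : x y / qlt x y},
    forall x, T (color x) (color (g x)) & {in p, forall u, g u.1 = u.2}].
Proof.
move=> Tl Tr pG.
have step (q : seq (nat * nat) * nat) : exists q', good T q.1 ->
    [/\ good T q', {subset q.1 <= q'}, q.2 \in unzip1 q' & q.2 \in unzip2 q'].
  case: (pselect (good T q.1)) => [qG|nG]; last by exists [::].
  have [m mG] := good_forth q.2 Tl qG.
  have [n nG] := good_back q.2 Tr mG.
  exists ((n, q.2) :: (q.2, m) :: q.1) => _; split=> //.
  - by move=> u uq; rewrite !inE uq !orbT.
  - by rewrite /= !inE eqxx orbT.
  - by rewrite /= mem_head.
have [next nextP] := choice step.
pose chain := fix chain k := if k is k'.+1 then next (chain k', k') else p.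
have chainG k : good T (chain k).
  by elim: k => //= k /(nextP (_, k))[].
have chainS k : [/\ good T (chain k.+1), {subset chain k <= chain k.+1},
    k \in unzip1 (chain k.+1) & k \in unzip2 (chain k.+1)].
  exact: (nextP (chain k, k) (chainG k)).
have chain_le k l : k <= l -> {subset chain k <= chain l}.
  move=> kl; rewrite -(subnK kl); elim: (l - k) => // i IH u /IH.
  by rewrite addSn; have [_ sub _ _] := chainS (i + k); apply: sub.
pose graph x y := exists k, (x, y) \in chain k.
have graph2 x y x' y' : graph x y -> graph x' y' ->
    exists2 k, (x, y) \in chain k & (x', y') \in chain k.
  move=> [k xy] [l xy']; exists (maxn k l).
    by apply: chain_le xy; apply: leq_maxl.
  by apply: chain_le xy'; apply: leq_maxr.
have [g gP] : exists g, forall x, graph x (g x).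
  have H x : exists y, graph x y.
    have [_ _ /mapP[[a b] ab ->] _] := chainS x; by exists b, x.+1.
  by have [g gP] := choice H; exists g.
have [h hP] : exists h, forall y, graph (h y) y.
  have H y : exists x, graph x y.
    have [_ _ _ /mapP[[a b] ab ->]] := chainS y; by exists a, y.+1.
  by have [h hP] := choice H; exists h.
have fun_graph x y y' : graph x y -> graph x y' -> y = y'.
  move=> xy /(graph2 _ _ _ _ xy)[k xyk xyk'].
  by apply: (order_pres_inj (proj1 (chainG k)) xyk xyk').
have inj_graph x x' y : graph x y -> graph x' y -> x = x'.
  move=> xy /(graph2 _ _ _ _ xy)[k xyk xyk'].
  apply: (order_pres_inj (order_pres_swap (proj1 (chainG k))) (x := y)).
    by apply/mapP; exists (x, y).
  by apply/mapP; exists (x', y).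
exists g; split.
- exists h => x; first exact: inj_graph (hP _) (gP x).
  exact: fun_graph (gP _) (hP x).
- move=> x y; have [k xk yk] := graph2 _ _ _ _ (gP x) (gP y).
  by have := proj1 (chainG k) _ _ xk yk.
- by move=> x; have [k xk] := gP x; have := proj2 (chainG k) _ xk.
- by move=> [a b] ab /=; apply: (fun_graph a); [exact: gP|exists 0].
Qed.

(** The colours of finitely many points can be prescribed by moving them along
    an automorphism of the order. *)
Lemma color_pattern (f : nat -> bool) n : exists g : nat -> nat,
  [/\ bijective g, {mono g : x y / qlt x y}
    & forall j, j < n -> color (g j) = f j].
Proof.
have [p [pP pn pf]] : exists p, [/\ order_pres p,
    (forall j, (j \in unzip1 p) = (j < n)) &
    {in p, forall u, color u.2 = f u.1}].
  elim: n => [|n [p [pP pn pf]]]; first by exists [::]; split.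
  have [|m [mf mP]] := @order_pres_cons p n (f n) pP; first by rewrite pn ltnn.
  exists ((n, m) :: p); split=> // [j|u].
    by rewrite /= inE pn ltnS [in RHS]leq_eqVlt.
  by rewrite inE => /predU1P[->|/pf].
have [|||g [gb gm _ gp]] := @extension (fun _ _ => true) p.
- by exists true.
- by exists true.
- by split.
exists g; split=> // j; rewrite -pn => /mapP[u up ->].
by rewrite gp // pf.
Qed.

(** * The two structures *)

(** A single binary relation symbol. *)
Definition order_sig : signature := @Signature void (fun _ => 0) unit (fun _ => 2).

(** The rational order. *)
Definition rat_order : structure order_sig nat :=
  @Structure order_sig nat (fun s => match s with end)
    (fun _ (t : 'I_2 -> nat) => qlt (t ord0) (t ord_max)).

(** The same signature with one more binary relation symbol. *)
Definition classes_sig : signature := expand_signature order_sig (fun _ : unit => 2).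

(** The expansion of the order by the equivalence relation whose two classes are
    the colour classes; the colours themselves are not named. *)
Definition rat_classes : structure classes_sig nat :=
  @Structure classes_sig nat (fun s => match s with end)
    (fun r => match r return ('I_(@rsym_arity classes_sig r) -> nat) -> Prop with
              | inl _ => fun t => qlt (t ord0) (t ord_max)
              | inr _ => fun t => color (t ord0) = color (t ord_max)
              end).

Lemma reduct_rat_classes : reduct rat_classes = rat_order. Proof. by []. Qed.

(** The pair [(x, y)] as an argument of a binary relation symbol. *)
Definition pair_fun T (x y : T) (i : 'I_2) : T := if i == ord0 then x else y.

Lemma iso_rat_order (S S' : set nat) (hS : substructure rat_order S)
    (hS' : substructure rat_order S') (f : S -> S') :
  isomorphism (induced hS) (induced hS') f ->
  forall x y : S, qlt (set_val x) (set_val y) =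
                  qlt (set_val (f x)) (set_val (f y)).
Proof.
by move=> [_ _ fr] x y; have /= [xy yx] := fr tt (pair_fun x y); apply/idP/idP.
Qed.

Lemma iso_rat_classes (S S' : set nat) (hS : substructure rat_classes S)
    (hS' : substructure rat_classes S') (f : S -> S') :
  isomorphism (induced hS) (induced hS') f ->
  (forall x y : S, qlt (set_val x) (set_val y) =
                   qlt (set_val (f x)) (set_val (f y))) /\
  (forall x y : S, color (set_val x) = color (set_val y) <->
                   color (set_val (f x)) = color (set_val (f y))).
Proof.
move=> [_ _ fr]; split=> x y.
  by have /= [xy yx] := fr (inl tt) (pair_fun x y); apply/idP/idP.
exact: (fr (inr tt) (pair_fun x y)).
Qed.

Lemma aut_rat_orderP g :
  isomorphism rat_order rat_order g <-> bijective g /\ {mono g : x y / qlt x y}.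
Proof.
split=> [[gb _ gr]|[gb gm]].
  split=> // x y; have /= [xy yx] := gr tt (pair_fun x y).
  exact/idP/idP.
by split=> // r t /=; rewrite gm.
Qed.

Lemma aut_rat_classesP g :
  isomorphism rat_classes rat_classes g <-> isomorphism rat_order rat_order g /\
    (forall x y, color x = color y <-> color (g x) = color (g y)).
Proof.
rewrite aut_rat_orderP; split=> [[gb _ gr]|[[gb gm] gc]].
  split; [split=> // x y|move=> x y].
    have /= [xy yx] := gr (inl tt) (pair_fun x y).
    exact/idP/idP.
  exact: (gr (inr tt) (pair_fun x y)).
by split=> // -[r|r] t /=; rewrite ?gm.
Qed.

(** The graph of a function on a finite set, as a sequence of pairs. *)
Lemma finite_graph (S : set nat) (f : S -> nat) : finite_set S ->
  exists p : seq (nat * nat), (forall x : S, (set_val x, f x) \in p) /\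
    (forall u, u \in p -> exists x : S, u = (set_val x, f x)).
Proof.
move=> /finite_seqP[s Ss].
exists [seq (set_val x, f x) | x <- pmap insub s]; split=> [x|u /mapP[x _ ->]].
  apply: map_f; rewrite mem_pmap_sub.
  by have := set_valP x; rewrite {1}Ss.
by exists x.
Qed.

Lemma locally_finite_rel (L : signature) (M : structure L nat) :
  (Defs.fsym L -> False) -> locally_finite M.
Proof.
move=> noF A; apply: sub_finite_set => x; apply.
by split=> // s; case: (noF s).
Qed.

Lemma rat_order_Fraisse : Fraisse rat_order.
Proof.
split=> [|S S' hS hS' f Sfin _ /iso_rat_order fm]; first exact: locally_finite_rel.
have [p [pS Sp]] := finite_graph (fun x => set_val (f x)) Sfin.
have [|||g [gb gm _ gp]] := @extension (fun _ _ => true) p.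
- by exists true.
- by exists true.
- by split=> // _ _ /Sp[x ->] /Sp[y ->]; apply: fm.
by exists g; [apply/aut_rat_orderP|move=> x; have /= := gp _ (pS x)].
Qed.

(** A map that preserves the equivalence relation in both directions either
    preserves all the colours or exchanges them all; this is the relation that
    the back-and-forth has to keep. *)
Lemma rat_classes_Fraisse : Fraisse rat_classes.
Proof.
split=> [|S S' hS hS' f Sfin _ /iso_rat_classes[fm fc]]; first exact: locally_finite_rel.
have [p [pS Sp]] := finite_graph (fun x => set_val (f x)) Sfin.
have [e fe] : exists e, forall x : S,
    color (set_val (f x)) = color (set_val x) (+) e.
  (* when [S] is empty any [e] will do *)
  case: (pselect (exists x : S, True)) => [[x0 _]|none]; last first.
    by exists true => x; case: none; exists x.
  exists (color (set_val x0) (+) color (set_val (f x0))) => x.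
  have := fc x x0; move: (color _) (color _) (color _) (color _).
  by do 4!case; case=> h1 h2 //; do ?[by move: (h1 erefl)|by move: (h2 erefl)].
have [|||g [gb gm gc gp]] := @extension (fun a b => b == a (+) e) p.
- by move=> a; exists (a (+) e).
- by move=> b; exists (b (+) e); rewrite addbK.
- split=> [_ _ /Sp[x ->] /Sp[y ->]|_ /Sp[x ->]]; first exact: fm.
  by rewrite /= fe.
exists g => [|x]; last by have /= := gp _ (pS x).
apply/aut_rat_classesP; split=> [|x y]; first exact/aut_rat_orderP.
rewrite (eqP (gc x)) (eqP (gc y)); split=> [->//|/addIb//].
Qed.

Lemma rat_classes_precompact : precompact_expansion rat_order rat_classes.
Proof.
move=> T A _.
pose mk (r : {ffun {ffun 'I_2 -> T} -> bool}) : structure classes_sig T :=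
  @Structure classes_sig T (fun s => match s with end)
    (fun s => match s return ('I_(@rsym_arity classes_sig s) -> T) -> Prop with
              | inl s => fun t => @rel_interp order_sig T A s t
              | inr _ => fun t => r [ffun i => t i]
              end).
apply: (@sub_finite_set _ _ (mk @` setT)); last exact/finite_image/finite_finset.
(* an expansion of [A] is determined by its new relation *)
move=> [fi ri] [rA _].
exists [ffun t : {ffun 'I_2 -> T} => `[< ri (inr tt) t >]] => //.
rewrite /mk -rA; congr Structure; first by apply: functional_extensionality_dep; case.
apply: functional_extensionality_dep => -[s|[]] //.
apply/funext => t; rewrite ffunE asboolE; congr (ri _ _).
by apply/funext => i; rewrite ffunE.
Qed.

(** * Failure of the Ramsey property *)

Section Pullback.
Variables (T : finType) (f : T -> nat).

(** The structure that makes [f] an embedding. *)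
Definition pullback : structure classes_sig T :=
  @Structure classes_sig T (fun s => match s with end)
    (fun r t => rel_interp rat_classes (f \o t)).

Lemma pullback_age : injective f -> Age rat_classes pullback.
Proof. by move=> fI; exists f; split=> // -[]. Qed.

End Pullback.

(** Points are copies of the one-point structure. Colour them by their class:
    a copy of a pair of inequivalent points gets two colours. *)
Lemma rat_classes_not_Ramsey : ~ Ramsey_property (Age rat_classes).
Proof.
have [z zc] : exists z : bool -> nat, forall b, color (z b) = b.
  have H b : exists n, color n = b.
    by have [n []] := @color_dense b 0%R 1%R ltr01; exists n.
  by have [z zP] := choice H; exists z.
pose A := pullback (fun _ : unit => 0); pose B := pullback z.
move=> /(_ 2 unit bool A B)[||TC [C [[e [eI _ er]] CR]]].
- by apply: pullback_age => -[] [].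
- by apply: pullback_age => a b /(congr1 color); rewrite !zc.
pose c (S : copies C A) : 'I_2 :=
  if `[< exists2 x, set_val S x & color (e x) >] then ord_max else ord0.
have [B' [hB' [f [_ _ fr]]] mono] := CR c.
have sub1 (x : TC) : substructure C [set x] by case.
have copy1 (x : TC) : copies C A [set x].
  pose x1 : [set x] := exist _ x (mem_set (erefl x)).
  exists (sub1 x), (fun _ => x1); split.
  - exists (fun _ => tt) => [[]//|[y yx]]; apply: val_inj => /=.
    by move/set_mem: yx => ->.
  - by case.
  - by case=> [[]|[]] t /=; rewrite er /= ?qltxx.
pose pt x : copies C A := exist _ [set x] (mem_set (copy1 x)).
have c1 x : c (pt x) = if color (e x) then ord_max else ord0.
  rewrite /c; case: asboolP => [[y /= -> ->]//|nx].
  by case: ifP => // cx; case: nx; exists x.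
pose x b := set_val (f b).
have Bx b : [set x b] `<=` B' by move=> _ ->; apply: set_valP.
have := mono (pt (x true)) (pt (x false)) (Bx _) (Bx _).
rewrite !c1 => xx.
have : color (e (x true)) = color (e (x false)).
  by move: xx; do 2!case: (color _).
have /= := er (inr tt) (fun i => set_val (f (pair_fun true false i))).
move=> [_ erE] /erE; have /= := fr (inr tt) (pair_fun true false).
by move=> [_ frE] /frE; rewrite !zc.
Qed.

(** * The topology of automorphism groups *)

Section AutTopology.
Variables (L : signature) (M : structure L nat).

Lemma autK (g : Aut M) x : (g^-1%g : Aut M) (g x) = x.
Proof. exact: (congr1 (fun h : Aut M => h x) (mulVg g)). Qed.

Lemma nbhs_aut_eval (g : Aut M) x : nbhs g [set h : Aut M | h x = g x].
Proof.
have ev : continuous (fun h : Aut M => aut_fun h x).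
  move=> h; apply: (@continuous_comp _ _ _ (set_val : Aut M -> {ptws nat -> nat})
     (fun f : {ptws nat -> nat} => f x)).
    exact: initial_continuous.
  exact: (@proj_continuous nat (fun _ => nat) x).
exact: (ev g _ (discrete_set1 (g x))).
Qed.

Lemma nbhs_aut_eq (g : Aut M) (s : seq nat) :
  nbhs g [set h : Aut M | {in s, h =1 g}].
Proof.
elim: s => [|x s IH]; first by apply: filterS filterT => h _ y.
apply: filterS2 IH (nbhs_aut_eval g x) => h hs hx y.
by rewrite inE => /predU1P[->|/hs].
Qed.

(** The pointwise stabilizers of finite sets form a basis at the identity. *)
Lemma nbhs_aut_fix (U : set (Aut M)) : nbhs (1%g : Aut M) U ->
  exists s : seq nat, forall g : Aut M, {in s, forall x, g x = x} -> U g.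
Proof.
move=> U1; apply: contrapT => noseq.
have [u uP] : exists u : nat -> Aut M, forall n,
    {in iota 0 n, forall x, u n x = x} /\ ~ U (u n).
  have H n : exists g : Aut M, {in iota 0 n, forall x, g x = x} /\ ~ U g.
    apply: contrapT => no; apply: noseq; exists (iota 0 n) => g gn.
    by apply: contrapT => nUg; apply: no; exists g.
  by have [u uP] := choice H; exists u.
have cvu : {ptws, (fun n => aut_fun (u n)) @ \oo --> (id : nat -> nat)}.
  apply/pointwise_cvgP => x; apply/discrete_cvg.
  exists x.+1 => //= n xn; have [ux _] := uP n.
  by apply: ux; rewrite mem_iota.
case: U1 => /= V [[W oW <-] W1 VU].
have /cvu[N _ WN] : nbhs (id : {ptws nat -> nat}) W by exact: open_nbhs_nbhs.
have [_] := uP N; apply; apply: VU => /=.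
by have := WN N (leqnn N).
Qed.

End AutTopology.

(** * Extreme amenability of the automorphism group of the rational order *)

Lemma compact_seq_cover (Y : topologicalType) (O : Y -> set Y) :
  [set: Y] !=set0 -> compact [set: Y] -> (forall y, open (O y)) ->
  (forall y, O y y) ->
  exists D : seq Y, forall y, exists2 d, d \in D & O d y.
Proof.
move=> [y0 _] Yc Oo Oy.
pose PY : ptopologicalType := HB.pack_for ptopologicalType Y (isPointed.Build Y y0).
have cov : @cover_compact PY setT by rewrite -compact_cover.
have [y _|y _|D _ DO] := cov Y setT O; [exact: Oo|by exists y|].
exists (enum_fset D) => y; have [d dD Ody] := DO y I.
by exists d.
Qed.

Section FixedPoint.
Variables (L : signature) (M : structure L nat).
Variables (Y : topologicalType) (b : Aut M -> Y -> Y).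
Hypothesis bflow : flow b.

Lemma flow_mulK g h x : b h^-1%g x = b (g^-1 * h)^-1%g (b g^-1%g x).
Proof. by have [_ b1 bM _] := bflow; rewrite -bM invgM invgK -mulgA mulgV mulg1. Qed.

(** A point moved by [g] has a neighbourhood moved off itself by [g], even up to
    the action of the automorphisms fixing some finite set. *)
Lemma moved_nbhd y g : b g y <> y ->
  exists (O : set Y) (s : seq nat), [/\ open O, O y &
    forall (k k' : Aut M) (z w : Y), {in s, forall x, k x = x} ->
      {in s, forall x, k' x = x} -> O z -> O w -> b g (b k z) <> b k' w].
Proof.
have [[Yh _] b1 bM bc] := bflow.
move=> /eqP; rewrite open_hausdorff in Yh.
move=> /Yh[[V W] /= [yV yW] [Vo Wo VW0]].
pose N := W `&` (b g @^-1` V).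
have bcg : {for y, continuous (b g)}.
  move=> U /(bc (g, y))[[P Q] /= [Pg Qy] PQ]; apply: filterS Qy => z Qz.
  by apply: (PQ (g, z)); split=> //; exact: nbhs_singleton.
have Ny : nbhs (b 1%g y) N.
  rewrite b1; apply: filterI; first by apply: open_nbhs_nbhs; split=> //; apply/set_mem.
  by apply: bcg; apply: open_nbhs_nbhs; split=> //; apply/set_mem.
have [[P Q] /= [P1 Qy] PQ] := bc (1%g, y) _ Ny.
have [s sP] := nbhs_aut_fix P1.
exists (interior Q), s.
split=> [||k k' z w /sP Pk /sP Pk' /interior_subset Qz /interior_subset Qw E].
- exact: open_interior.
- exact: Qy.
have [_ Vz] := PQ (k, z) (conj Pk Qz); have [Ww _] := PQ (k', w) (conj Pk' Qw).
suff : (V `&` W) (b k' w) by rewrite (eqP VW0).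
by split=> //; rewrite -E.
Qed.

End FixedPoint.

Lemma qlt_sortable (s : seq nat) :
  exists2 s', sorted qlt s' & {subset s <= s'}.
Proof.
pose qle x y := (ratn x <= ratn y)%R.
exists (sort qle (undup s)); last by move=> x; rewrite mem_sort mem_undup.
have -> : qlt = relpre ratn <%R by [].
rewrite -sorted_map lt_sorted_uniq_le (map_inj_uniq ratn_inj) sort_uniq.
rewrite undup_uniq sorted_map; apply: sort_sorted => x y; exact: le_total.
Qed.

Lemma index_mono s : sorted qlt s ->
  {in s &, forall x y, (index x s < index y s) = qlt x y}.
Proof.
move=> ss x y xs ys; apply/idP/idP; first exact: (sorted_ltn_index qlt_trans ss).
move=> xy; rewrite ltnNge leq_eqVlt; apply/negP => /predU1P[yx|yx].
  by move: xy; rewrite (index_inj x ys xs yx) ?qltxx.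
by move: xy; rewrite (qlt_asym (sorted_ltn_index qlt_trans ss y x ys xs yx)).
Qed.

Lemma nat_embeds : exists f : nat -> nat, {mono f : i j / i < j >-> qlt i j}.
Proof.
have [inv _ invK] := ratn_bij; exists (fun n => inv n%:R%R) => i j.
by rewrite /qlt !invK ltr_nat.
Qed.

(** The automorphism group of the rational order is extremely amenable. *)
Theorem flow_fixed_point (Y : topologicalType) (b : Aut rat_order -> Y -> Y) :
  flow b -> compact [set: Y] -> exists y, forall g, b g y = y.
Proof.
move=> bflow Yc; apply: contrapT => nofix.
have [[_ [y0 _]] _ bM _] := bflow.
have [natq natq_mono] := nat_embeds.
(* [O y] is a neighbourhood of [y] moved off itself by [h y] *)
have [h hP] : exists h : Y -> Aut rat_order, forall y, b (h y) y <> y.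
  have H y : exists g, b g y <> y.
    apply: contrapT => nog; apply: nofix; exists y => g.
    by apply: contrapT => gy; apply: nog; exists g.
  by have [h hP] := choice H; exists h.
have [O OP] := choice (fun y => moved_nbhd bflow (hP y)).
have [S SP] := choice OP.
have [D DO] : exists D : seq Y, forall y, exists2 d, d \in D & O d y.
  by apply: compact_seq_cover => // [|y|y]; [exists y0|have [] := SP y|have [] := SP y].
have [A As AS] := qlt_sortable (flatten (map S D)).
have ASd d x : d \in D -> x \in S d -> x \in A.
  by move=> dD xd; apply: AS; apply/flattenP; exists (S d) => //; apply: map_f.
(* A set of the size of [A] gets the colour [d] if some [g] maps [A] to it with
   [g^-1 y0] in [O d]. *)
have [c cP] : exists c : seq nat -> Y, forall s, c s \in D /\
    forall g : Aut rat_order, map g A = map natq s ->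
    exists2 g' : Aut rat_order, map g' A = map natq s & O (c s) (b g'^-1%g y0).
  have H s : exists d, d \in D /\
      forall g : Aut rat_order, map g A = map natq s ->
      exists2 g' : Aut rat_order, map g' A = map natq s & O d (b g'^-1%g y0).
    case: (pselect (exists g : Aut rat_order, map g A = map natq s)) => [[g gs]|nog].
      by have [d dD Od] := DO (b g^-1%g y0); exists d; split=> // _ _; exists g.
    have [d dD _] := DO y0; exists d; split=> // g gs.
    by case: nog; exists g.
  by have [c cP] := choice H; exists c.
have [//|phi [d [phiI dD phid]]] := @ramsey Y D (size A) c.
  by move=> s; have [] := cP s.
have phim : {mono phi : i j / i < j} by apply: leqW_mono; apply: leq_mono.
(* Some [g] maps both [A] and its image under [h d] into the homogeneous set. *)
have [B Bs BS] := qlt_sortable (A ++ map (h d) A).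
have [g gP] : exists g : Aut rat_order, {in B, forall x, g x = natq (phi (index x B))}.
  have [|||g [gb gm _ gp]] := @extension (fun _ _ => true)
      [seq (x, natq (phi (index x B))) | x <- B].
  - by exists true.
  - by exists true.
  - split=> // _ _ /mapP[x xB ->] /mapP[y yB ->] /=.
    by rewrite natq_mono phim index_mono.
  exists (mk_aut (proj2 (aut_rat_orderP g) (conj gb gm))) => x xB.
  exact: (gp _ (map_f _ xB)).
(* If [k A] is contained in [B], then [g (k A)] has colour [d]. *)
have hom (k : Aut rat_order) : {in A, forall x, k x \in B} ->
    exists2 g' : Aut rat_order, {in A, forall x, g' x = g (k x)} & O d (b g'^-1%g y0).
  move=> kB; pose s := map (fun x => index (k x) B) A.
  have ss : sorted ltn s.
    apply: (homo_sorted_in (P := mem A)) As; last by apply/allP.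
    move=> x y xA yA xy /=; rewrite index_mono ?kB //.
    by have [_ km] := proj1 (aut_rat_orderP _) (aut_funP k); rewrite km.
  pose gk : Aut rat_order := (g * k)%g.
  have gks : map gk A = map natq (map phi s).
    by rewrite -!map_comp; apply/eq_in_map => x xA; apply: gP; apply: kB.
  have [_ /(_ _ gks)[g' g's]] := cP (map phi s).
  rewrite phid ?size_map // => Og'; exists g' => //.
  by apply/eq_in_map; rewrite g's -gks.
have [x xA|g1 g1A O1] := hom 1%g; first by apply: BS; rewrite mem_cat xA.
have [x xA|g2 g2A O2] := hom (h d).
  by apply: BS; rewrite mem_cat map_f ?orbT.
have fixS (k l : Aut rat_order) : {in A, forall x, k x = l x} ->
    {in S d, forall x, ((k^-1 * l)^-1%g : Aut rat_order) x = x}.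
  move=> kl x xd; rewrite invgM invgK; change ((l^-1%g : Aut rat_order) (k x) = x).
  by rewrite kl ?(ASd d) // autK.
(* [h d] maps [(g * h d)^-1 y0] to [g^-1 y0], and both points lie in [O d] up to
   automorphisms fixing [A]. *)
have [_ _ Oh] := SP d.
apply: (Oh _ _ _ _ (fixS g2 (g * h d)%g g2A) (fixS g1 g g1A) O2 O1).
by rewrite -!flow_mulK // -bM invgM mulgA mulgV mul1g.
Qed.

Lemma minimal_flow_trivial (Y : topologicalType) (b : Aut rat_order -> Y -> Y) :
  flow b -> compact [set: Y] -> minimal_flow b -> forall y y' : Y, y = y'.
Proof.
move=> bflow Yc bmin; have [y yfix] := flow_fixed_point bflow Yc.
suff eqy z : z = y by move=> z z'; rewrite (eqy z) (eqy z').
apply/eqP/negPn/negP => zy; have [[Yh _] _ _ _] := bflow.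
rewrite open_hausdorff in Yh; have [[V W] /= [zV yW] [Vo Wo VW]] := Yh _ _ zy.
have [|u [Vu [g _ gu]]] := bmin y V _ Vo; first by exists z; apply/set_mem.
suff : (V `&` W) y by rewrite (eqP VW).
by split; [rewrite -(yfix g) gu|apply/set_mem].
Qed.

(** * The space of equivalence relations with at most two classes *)

(** [g] and [h] coincide below [n]. *)
Definition agree (n : nat) (g h : nat -> nat) : Prop :=
  forall m, m < n -> g m = h m.

Section DistLeft.
Variable R : realType.
Local Open Scope ring_scope.
Local Notation dist := (dist_left R).

Lemma dist_left_spec g h :
  (exists e, [/\ agree e g h, g e <> h e & dist g h = 2 ^- e]) \/
  (g = h /\ dist g h = 0).
Proof.
rewrite /dist_left; case: pselect => [ex|nex].
  left; case: ex_minnP => e /eqP ge emin; exists e; split=> // m me.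
  by apply/eqP/negPn/negP => /emin; rewrite leqNgt me.
right; split=> //; apply/funext => n; apply/eqP/negPn/negP => gn.
by apply: nex; exists n.
Qed.

Lemma dist_left_ge0 g h : 0 <= dist g h.
Proof.
have [[e [_ _ ->]]|[_ ->//]] := dist_left_spec g h.
by rewrite invr_ge0 exprn_ge0.
Qed.

Lemma dist_left_agree n g h : (dist g h <= 2 ^- n) <-> agree n g h.
Proof.
have [[e [ge gne ->]]|[-> ->]] := dist_left_spec g h; last first.
  by split=> // _; rewrite invr_ge0 exprn_ge0.
rewrite lef_pV2 ?posrE ?exprn_gt0 // ler_eXn2l ?ltr1n //.
split=> [ne m mn|gn]; first by apply: ge; apply: leq_trans mn ne.
by rewrite leqNgt; apply/negP => /gn.
Qed.

Lemma dist_left_le g h g' h' : (forall n, agree n g h -> agree n g' h') ->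
  dist g' h' <= dist g h.
Proof.
move=> gh; have [[e [ge _ ->]]|[E ->]] := dist_left_spec g h.
  by apply/dist_left_agree/gh.
have [[e [_ ne _]]|[_ -> //]] := dist_left_spec g' h'.
by case: ne; apply: (gh e.+1) => // m _; rewrite E.
Qed.

Lemma dist_leftxx g : dist g g = 0.
Proof. by have [[e [_ //]]|[_ ->]] := dist_left_spec g g. Qed.

Lemma dist_left_sym g h : dist g h = dist h g.
Proof.
by apply/le_anti/andP; split; apply: dist_left_le => n gh m mn; rewrite gh.
Qed.

(** The distance is even an ultrametric: where [x] and [z] differ first, [y]
    differs from one of them. *)
Lemma dist_left_triangle y x z : dist x z <= dist x y + dist y z.
Proof.
have [[e [_ ne E]]|[_ ->]] := dist_left_spec x z; last first.
  by rewrite addr_ge0 ?dist_left_ge0.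
have far g h : g e <> h e -> dist x z <= dist g h.
  move=> ge; have [[d [gd _ ->]]|[gh]] := dist_left_spec g h; last by case: ge; rewrite gh.
  rewrite E lef_pV2 ?posrE ?exprn_gt0 // ler_eXn2l ?ltr1n // leqNgt.
  by apply/negP => /gd.
have [xy|/eqP xy] := eqVneq (x e) (y e).
  have yz : y e <> z e by rewrite -xy.
  by apply: le_trans (far _ _ yz) _; rewrite lerDr dist_left_ge0.
by apply: le_trans (far _ _ xy) _; rewrite lerDl dist_left_ge0.
Qed.

Lemma half_pow_small (e : R) : 0 < e -> exists n, 2 ^- n < e :> R.
Proof.
move=> e0; have einv : 0 <= e^-1 by rewrite invr_ge0 ltW.
exists (Num.bound e^-1); rewrite invf_plt ?posrE ?exprn_gt0 //.
exact: upper_nthrootP.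
Qed.

End DistLeft.

(** The space of equivalence relations on [nat] with at most two classes. Such a
    relation is determined by the class of [0], and [f : nat -> bool] encodes
    the one in which [n.+1] is equivalent to [0] when [f n]. The parameter [R]
    only serves to attach an [R]-valued metric to the type. *)
Definition two_classes (R : realType) : Type := nat -> bool.

HB.instance Definition _ (R : realType) := Choice.on (two_classes R).

Section Completion.
Variable R : realType.
Local Notation X := (two_classes R).

(** The class of [0], which always contains [0]. *)
Definition class0 (f : X) (n : nat) : bool := if n is m.+1 then f m else true.

Lemma class0_inj (f h : X) : class0 f =1 class0 h -> f = h.
Proof. by move=> fh; apply/funext => n; exact: (fh n.+1). Qed.

(** The same class with values in [nat], so that [dist_left] applies. *)
Definition class0_nat (f : X) (n : nat) : nat := class0 f n.

(** The distance is [2 ^- n], for [n] the first element of [nat] that lies in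
    the class of [0] for only one of the two relations. *)
Definition class_dist (f h : X) : R :=
  dist_left R (class0_nat f) (class0_nat h).

Lemma class_dist_eq0 f h : class_dist f h = 0%R -> f = h.
Proof.
rewrite /class_dist.
have [[e [_ _ ->]]|[fh _] _] :=
  dist_left_spec R (class0_nat f) (class0_nat h).
  by move/eqP; rewrite invr_eq0 expf_eq0 pnatr_eq0 andbF.
apply: class0_inj => n; have /(congr1 (@^~ n)) := fh.
by rewrite /class0_nat; do 2!case: class0.
Qed.

HB.instance Definition _ := isMetric.Build R X
  (fun f => dist_leftxx R (class0_nat f)) class_dist_eq0
  (fun f h => dist_left_sym R (class0_nat f) (class0_nat h))
  (fun h f k => dist_left_triangle R (class0_nat h) (class0_nat f) (class0_nat k)).

(** The classes of [0] coincide below [n]. *)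
Definition agree_classes n (f h : X) : Prop :=
  forall m, m < n -> class0 f m = class0 h m.

Lemma agree_classesP n f h :
  agree_classes n f h <-> agree n (class0_nat f) (class0_nat h).
Proof.
split=> fh m mn; first by rewrite /class0_nat fh.
by have := fh m mn; rewrite /class0_nat; do 2!case: class0.
Qed.

Lemma class_distP n f h : (mdist f h <= 2 ^- n)%R <-> agree_classes n f h.
Proof. by rewrite agree_classesP; exact: dist_left_agree. Qed.

Lemma two_classes_nbhsP (f : X) (U : set X) :
  nbhs f U <-> exists n, forall h, agree_classes n f h -> U h.
Proof.
split=> [/nbhs_ballP[e /= e0 eU]|[n nU]].
  have [n ne] := half_pow_small e0; exists n => h /class_distP fh.
  by apply: eU; rewrite ballEmdist /=; apply: le_lt_trans fh ne.
apply/nbhs_ballP; exists (2 ^- n)%R; first by rewrite /= invr_gt0 exprn_gt0.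
by move=> h; rewrite ballEmdist /= => /ltW/class_distP; exact: nU.
Qed.

Lemma two_classes_complete (F : set_system X) : ProperFilter F -> cauchy F ->
  exists f : X, F --> f.
Proof.
move=> FF /cauchyP Fc.
have [x xF] : exists x : nat -> X, forall n, F [set h | agree_classes n (x n) h].
  have H n : exists x : X, F [set h | agree_classes n x h].
    have [|x xF] := Fc (2 ^- n)%R; first by rewrite invr_gt0 exprn_gt0.
    exists x; apply: filterS xF => h; rewrite ballEmdist /= => /ltW.
    by move/class_distP.
  by have [x xF] := choice H; exists x.
(* the [k]-th value decides whether [k.+1] lies in the class of [0], which is
   settled by agreement below [k.+2] *)
exists (fun k => x k.+2 k) => U /two_classes_nbhsP[n nU].
apply: (@filterS _ F _ _ _ nU).
elim: n {nU} => [|n IH]; first by apply: filterS filterT => h _ m.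
apply: filterS2 IH (xF n.+1) => h hn hx m; rewrite ltnS leq_eqVlt.
move=> /predU1P[->|/hn//]; case: n {hn} hx => [//|n] hx.
exact: (hx n.+1).
Qed.

(** * The action of the automorphisms of the rational order *)

Local Notation G := (Aut rat_order).

(** [g] maps an equivalence relation to the one in which [x] and [y] are
    equivalent when [g^-1 x] and [g^-1 y] were. *)
Definition classes_act (g : G) (f : X) : X :=
  fun n => class0 f ((g^-1%g : G) 0) == class0 f ((g^-1%g : G) n.+1).

Lemma class0_classes_act g f m : class0 (classes_act g f) m =
  (class0 f ((g^-1%g : G) 0) == class0 f ((g^-1%g : G) m)).
Proof. by case: m => [|m] //=; rewrite eqxx. Qed.

(** The image under [g] of the equivalence relation of [rat_classes]. *)
Definition base (g : G) : X :=
  fun n => color ((g^-1%g : G) 0) == color ((g^-1%g : G) n.+1).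

Lemma class0_base g m : class0 (base g) m =
  (color ((g^-1%g : G) 0) == color ((g^-1%g : G) m)).
Proof. by case: m => [|m] //=; rewrite eqxx. Qed.

Lemma aut_invM (g h : G) x :
  ((g * h)^-1%g : G) x = (h^-1%g : G) ((g^-1%g : G) x).
Proof. by rewrite invgM. Qed.

Lemma classes_act_base g h : classes_act g (base h) = base (g * h)%g.
Proof.
apply: class0_inj => m; rewrite class0_classes_act !class0_base !aut_invM.
by do 3!case: color.
Qed.

(** Every finite pattern of classes is realized by an image of the equivalence
    relation. *)
Lemma base_dense : dense (range base).
Proof.
move=> O [f Of] Oo; have /two_classes_nbhsP[n nO] : nbhs f O by exact: open_nbhs_nbhs.
have [g [gb gm gc]] := color_pattern (class0 f) n.
pose g' : G := mk_aut (proj2 (aut_rat_orderP g) (conj gb gm)).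
exists (base (g'^-1%g)); split; last by exists g'^-1%g.
apply: nO => m mn; rewrite class0_base invgK.
have g'E x : (g' : G) x = g x by [].
rewrite !g'E (gc m mn) gc; first by case: class0.
exact: leq_ltn_trans mn.
Qed.

Lemma aut_keep_inv (g h : G) x : h ((g^-1%g : G) x) = x ->
  (h^-1%g : G) x = (g^-1%g : G) x.
Proof. by move=> hx; rewrite -{1}hx autK. Qed.

Lemma classes_act_flow : flow classes_act.
Proof.
split.
- by split; [exact: metric_hausdorff|exists (fun _ => true)].
- by move=> f; apply: class0_inj => m; rewrite class0_classes_act invg1 /=; case: class0.
- move=> g h f; apply: class0_inj => m; rewrite !class0_classes_act !aut_invM.
  by do 3!case: class0.
move=> [g0 f] U /= /two_classes_nbhsP[n nU]; pose g : G := g0.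
(* below [n], the image relation depends on [g^-1 0], on the points [g^-1 m] for
   [m < n], and on the class of [0] for [f] at these points *)
pose s := [seq (g^-1%g : G) m | m <- iota 0 n.+1].
pose N := (\max_(x <- s) x).+1.
exists ([set h : G | {in s, h =1 g}], [set h | agree_classes N f h]).
  by split; [exact: nbhs_aut_eq|apply/two_classes_nbhsP; exists N].
move=> [h0 f'] /= [hs ff']; pose h : G := h0; apply: nU => m mn.
have hg k : k <= n -> (h^-1%g : G) k = (g^-1%g : G) k.
  move=> kn; apply: aut_keep_inv; rewrite hs; first last.
    by apply: map_f; rewrite mem_iota.
  by have := autK (g^-1%g) k; rewrite invgK.
have f'g k : k <= n -> class0 f' ((g^-1%g : G) k) = class0 f ((g^-1%g : G) k).
  move=> kn; rewrite ff' // ltnS; apply: (@leq_bigmax_seq _ _ xpredT id) => //.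
  by apply: map_f; rewrite mem_iota.
by rewrite !class0_classes_act !hg ?f'g // ltnW.
Qed.

Lemma classes_act_universal : universal_flow classes_act.
Proof.
move=> Y b bflow Yc bmin.
have triv := minimal_flow_trivial bflow Yc bmin.
have [[_ [y0 _]] _ _ _] := bflow.
exists (fun _ => y0); split; first exact: cst_continuous.
  apply/seteqP; split=> // y _; exists (fun _ => true) => //; exact: triv.
by move=> g x; exact: triv.
Qed.

(** * Cosets *)

Local Notation Q :=
  (@coset_space order_sig unit (fun _ => 2) rat_order rat_classes).
Local Notation proj :=
  (@coset_proj order_sig unit (fun _ => 2) rat_order rat_classes).

(** The equivalence relation is fixed by [Aut rat_classes]. *)
Lemma base_coset (g h : G) : left_coset rat_classes g h -> base h = base g.
Proof.
move=> [k kH <-]; apply: class0_inj => m; rewrite !class0_base !aut_invM.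
have [_ kc] := proj1 (aut_rat_classesP _) kH.
have := kc ((k^-1%g : G) ((g^-1%g : G) 0)) ((k^-1%g : G) ((g^-1%g : G) m)).
have kK x : k ((k^-1%g : G) x) = x by have := autK (k^-1%g) x; rewrite invgK.
by rewrite !kK => -[h1 h2]; apply/eqP/eqP.
Qed.

(** The embedding of the cosets in the space of equivalence relations. By
    [base_coset] the choice of the representative is irrelevant; the default
    value [1] is never used, as cosets are not empty. *)
Definition coset_base (p : Q) : X := base (xget 1%g (set_val p)).

Lemma left_coset_refl (g : G) : left_coset rat_classes g g.
Proof.
exists 1%g; last by rewrite mulg1.
by apply/aut_rat_classesP; split; first exact: aut_funP.
Qed.

Lemma coset_base_proj g : coset_base (proj g) = base g.
Proof.
apply: base_coset; rewrite /coset_base.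
by apply: (@xgetPex _ (1%g : G) (left_coset rat_classes g)); exists g; exact: left_coset_refl.
Qed.

Lemma proj_surj (p : Q) : exists g, p = proj g.
Proof.
case: p => p pP; have [g _ gp] := set_mem pP; exists g.
by apply: val_inj => /=.
Qed.

(** Conversely, [base] separates the cosets. *)
Lemma base_eq (g h : G) : base g = base h -> left_coset rat_classes h g.
Proof.
move=> gh; exists (h^-1 * g)%g; last by rewrite mulgA mulgV mul1g.
apply/aut_rat_classesP; split; first exact: aut_funP.
have gK x : (g^-1%g : G) (g x) = x by exact: autK.
have eqc x : (color ((g^-1%g : G) 0) == color x) =
    (color ((h^-1%g : G) 0) == color ((h^-1%g : G) (g x))).
  by have := congr1 (class0 ^~ (g x)) gh; rewrite !class0_base gK.
move=> x y; have cx := eqc x; have cy := eqc y.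
change ((color x = color y) <->
  (color ((h^-1%g : G) (g x)) = color ((h^-1%g : G) (g y)))).
by move: cx cy; do 6!case: color.
Qed.

(** If the images of the equivalence relation under [g] and [h] agree below [n],
    then [h] can be changed in its coset to have an inverse that agrees with the
    inverse of [g] below [n]: the finite map from [g^-1 j] to [h^-1 j] extends
    to an automorphism of [rat_classes]. *)
Lemma coset_agree n (g h : G) : agree_classes n (base g) (base h) ->
  exists2 h', left_coset rat_classes h h' &
    agree n (g^-1%g : G) (h'^-1%g : G).
Proof.
move=> gh; pose e := color ((g^-1%g : G) 0) (+) color ((h^-1%g : G) 0).
pose p := [seq ((g^-1%g : G) j, (h^-1%g : G) j) | j <- iota 0 n].
have [|||k [kb km kc kp]] := @extension (fun a b => b == a (+) e) p.
- by move=> a; exists (a (+) e).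
- by move=> b; exists (b (+) e); rewrite addbK.
- split.
    move=> _ _ /mapP[i _ ->] /mapP[j _ ->] /=.
    have [_ gm] := proj1 (aut_rat_orderP _) (aut_funP (g^-1%g)).
    have [_ hm] := proj1 (aut_rat_orderP _) (aut_funP (h^-1%g)).
    by rewrite gm hm.
  move=> _ /mapP[j + ->] /=; rewrite mem_iota => /gh.
  by rewrite !class0_base /e; do 4!case: color.
have kF : isomorphism rat_order rat_order k by apply/aut_rat_orderP.
exists (h * mk_aut kF)%g.
  exists (mk_aut kF) => //; apply/aut_rat_classesP; split=> // x y.
  by rewrite (eqP (kc x)) (eqP (kc y)); split=> [->|/addIb].
move=> j jn; rewrite aut_invM.
have /= <- := kp _ (map_f (fun j => ((g^-1%g : G) j, (h^-1%g : G) j))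
  (_ : j \in iota 0 n)); last by rewrite mem_iota.
by rewrite -[k _]/(mk_aut kF _) autK.
Qed.

Lemma coset_dist_base (p q : Q) :
  mdist (coset_base p) (coset_base q) = coset_dist R p q.
Proof.
have [g ->] := proj_surj p; have [h ->] := proj_surj q.
rewrite !coset_base_proj /coset_dist.
set S := [set r | _].
have lb : lbound S (mdist (base g) (base h)).
  move=> _ [g' [h' [gg' hh' ->]]].
  rewrite -(base_coset gg') -(base_coset hh'); apply: dist_left_le => n gh.
  apply/agree_classesP => m mn; rewrite !class0_base !gh //.
  exact: leq_ltn_trans mn.
have [r Sr rle] : exists2 r, S r & (r <= mdist (base g) (base h))%R.
  have [[e [ge _ E]]|[E _]] :=
      dist_left_spec R (class0_nat (base g)) (class0_nat (base h)).
    have [h' hh' gh'] := coset_agree (proj2 (agree_classesP _ _ _) ge).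
    exists (dist_right R g h').
      by exists g, h'; split=> //; exact: left_coset_refl.
    by rewrite [leRHS]E; apply/dist_left_agree.
  have hg : left_coset rat_classes h g.
    apply: base_eq; apply: class0_inj => m.
    by apply: (proj2 (agree_classesP m.+1 _ _)); rewrite ?E.
  exists (dist_right R g g); first by exists g, g; split=> //; exact: left_coset_refl.
  by rewrite /dist_right dist_leftxx dist_left_ge0.
apply/le_anti/andP; split; first by apply: lb_le_inf => //; exists r.
by apply: le_trans rle; apply: ge_inf => //; exists (mdist (base g) (base h)).
Qed.

End Completion.

Theorem mainTheorem5 (R : realType) :
  exists (L : signature) (I : countType) (ar : I -> nat)
         (F : structure L nat) (Fs : structure (expand_signature L ar) nat),
    [/\ Fraisse F, Fraisse Fs, reduct Fs = F & precompact_expansion F Fs] /\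
    (exists (X : metricType R) (i : coset_space F Fs -> X)
            (a : Aut F -> X -> X),
       [/\ is_completion (coset_dist R) i,
           flow a, extends_left_mul i a & universal_flow a]) /\
    ~ Ramsey_property (Age Fs).
Proof.
exists order_sig, unit, (fun _ => 2), rat_order, rat_classes; split.
  split; [exact: rat_order_Fraisse|exact: rat_classes_Fraisse| |].
    exact: reduct_rat_classes.
  exact: rat_classes_precompact.
split; last exact: rat_classes_not_Ramsey.
exists (two_classes R), (@coset_base R), (@classes_act R); split.
- split; [exact: coset_dist_base| |exact: two_classes_complete].
  move=> O On Oo; have [f [Of [g _ gf]]] := base_dense On Oo.
  exists f; split=> //; exists (coset_proj rat_classes g) => //.
  by rewrite coset_base_proj.
- exact: classes_act_flow.
- by move=> g h; rewrite !coset_base_proj classes_act_base.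
- exact: classes_act_universal.
Qed.
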